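(* Let $K_{ff}=K_{ff}^{T}$ be invertible at a configuration $(k,a)$ (whether $a=0$ or an exceptional $a\ne0$ leaving $K_{ff}$ symmetric), let $C=K_{ff}^{-1}$, and set $w_b=Cq_b$ and $z_b=Cs_b$. At any such configuration, $$\Pi_{\mathcal{A}_P}\Bigl(\operatorname{im}\frac{\partial R}{\partial(k,a)}\Bigr)=\operatorname{span}\bigl\{z_b|_P\wedge w_b|_P:\ b=1,\dots,n_b\bigr\}\subseteq\Lambda^2\mathbb{R}^p.$$ Therefore $\Pi_{\mathcal{A}_P}(\operatorname{im}\partial R/\partial(k,a))=\mathcal{A}_P$ if and only if those $n_b$ wedges span $\Lambda^2\mathbb{R}^p$. A single bond $b$ contributes nothing exactly when $z_b|_P$ and $w_b|_P$ are linearly dependent (which includes the case where one of them vanishes), and every contribution vanishes when $p\le1$.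
   Context: Network: $N$ point nodes at positions $x_i\in\mathbb{R}^2$ are joined by $n_b$ bonds. For a bond $b=(i,j)$ of length $L_b=|x_j-x_i|>0$ let $\hat n_b=(x_j-x_i)/L_b$ and let $\hat t_b$ be $\hat n_b$ rotated by $+90^\circ$. The vector $q_b\in\mathbb{R}^{2N}$ carries $-\hat n_b$ at node $i$, $+\hat n_b$ at node $j$, zeros elsewhere; $s_b$ is the same with $\hat t_b$. For stiffnesses $k=(k_b)$, $k_b>0$, and odd couplings $a=(a_b)\in\mathbb{R}^{n_b}$, $K=\sum_b(k_bq_b+a_bs_b)q_b^{T}$. Three degrees of freedom are pinned to remove the planar rigid-body modes and $K_{ff}$ is the restriction of $K$ to the remaining $n_{\mathrm{free}}=2N-3$ free ones. In $Cq_b$, $Cs_b$ the vectors $q_b,s_b$ are restricted to the free degrees of freedom. Response block: $S$ (driven) and $T$ (read) are sets of free degrees of freedom, $|S|=m_S$, $|T|=m_T$, $P=T\cap S$, $p=|P|$, $R(k,a)=C[T,S]$; $v|_P$ is the restriction of a vector to the coordinates in $P$. $\tau,\sigma$ give the positions of elements of $P$ inside $T$ and $S$. $\mathcal{S}_P=\{A\in\mathbb{R}^{m_T\times m_S}:A_{\tau(r)\sigma(c)}=A_{\tau(c)\sigma(r)}\ \forall r,c\in P\}$, $\mathcal{A}_P=\mathcal{S}_P^{\perp}$ (trace inner product), $\Pi_{\mathcal{A}_P}$ the orthogonal projection. $u\wedge v=uv^{T}-vu^{T}$, $\Lambda^2\mathbb{R}^p$ is the space of antisymmetric $p\times p$ matrices,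 and with a fixed ordering of $P$, $\mathcal{A}_P$ is identified with $\Lambda^2\mathbb{R}^p$ by sending $E_{\tau(r)\sigma(c)}-E_{\tau(c)\sigma(r)}$ to $e_r\wedge e_c$. *)

(* Defs.v *)
From HB Require Import structures.
From mathcomp Require Import all_boot all_order all_algebra.
From mathcomp Require Import boolp classical_sets functions reals.
From mathcomp Require Import topology normedtype derive.

Set Implicit Arguments.
Unset Strict Implicit.
Unset Printing Implicit Defensive.

Import Order.TTheory GRing.Theory Num.Theory.
Import numFieldNormedType.Exports.

Local Open Scope classical_set_scope.
Local Open Scope ring_scope.

Definition enumerates (X : finType) (n : nat) (e : 'I_n -> X) (A : {set X}) :=
  injective e /\ [set e i | i : 'I_n]%SET = A.

Definition rot90 (R : realType) (v : 'cV[R]_2) : 'cV[R]_2 :=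
  \col_c (if c == 0 then - v 1 0 else v 0 0).

Definition bond_vec (R : realType) (N : nat) (x : 'I_N -> 'cV[R]_2)
  (e : 'I_N * 'I_N) : 'cV[R]_2 := x e.2 - x e.1.

(* Euclidean length; the norm [`|_|] on matrices is the sup norm. *)
Definition bond_len (R : realType) (N : nat) (x : 'I_N -> 'cV[R]_2)
  (e : 'I_N * 'I_N) : R := Num.sqrt (\sum_c bond_vec x e c 0 ^+ 2).

Definition bond_n (R : realType) (N : nat) (x : 'I_N -> 'cV[R]_2)
  (e : 'I_N * 'I_N) : 'cV[R]_2 := (bond_len x e)^-1 *: bond_vec x e.

Definition bond_t (R : realType) (N : nat) (x : 'I_N -> 'cV[R]_2)
  (e : 'I_N * 'I_N) : 'cV[R]_2 := rot90 (bond_n x e).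

(* A field of planar vectors on the nodes is a 2 x N matrix whose column [m]
   sits at node [m]; [mxvec] flattens it, which numbers the 2N degrees of
   freedom. *)
Definition dipole (R : realType) (N : nat) (e : 'I_N * 'I_N) (v : 'cV[R]_2) :
    'cV[R]_(2 * N) :=
  (mxvec (\matrix_(c < 2, m < N)
            (((m == e.2)%:R - (m == e.1)%:R) * v c 0)))^T.

Definition q_vec (R : realType) (N : nat) (x : 'I_N -> 'cV[R]_2)
  (e : 'I_N * 'I_N) : 'cV[R]_(2 * N) := dipole e (bond_n x e).

Definition s_vec (R : realType) (N : nat) (x : 'I_N -> 'cV[R]_2)
  (e : 'I_N * 'I_N) : 'cV[R]_(2 * N) := dipole e (bond_t x e).

Definition stiffness (R : realType) (N nb : nat) (x : 'I_N -> 'cV[R]_2)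
    (bond : 'I_nb -> 'I_N * 'I_N) (k a : 'rV[R]_nb) : 'M[R]_(2 * N) :=
  \sum_(b < nb) (k 0 b *: q_vec x (bond b) + a 0 b *: s_vec x (bond b))
                *m (q_vec x (bond b))^T.

Definition rigid_motion (R : realType) (N : nat) (x : 'I_N -> 'cV[R]_2)
    (t : 'cV[R]_2) (omega : R) : 'rV[R]_(2 * N) :=
  mxvec (\matrix_(c < 2, m < N) (t + omega *: rot90 (x m)) c 0).

Definition removes_rigid (R : realType) (N : nat) (x : 'I_N -> 'cV[R]_2)
    (pinned : {set 'I_(2 * N)}) :=
  forall t omega, (forall i, i \in pinned -> rigid_motion x t omega 0 i = 0) ->
    rigid_motion x t omega = 0.

Definition K_ff (R : realType) (N nb : nat) (x : 'I_N -> 'cV[R]_2)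
    (bond : 'I_nb -> 'I_N * 'I_N) (free : 'I_(2 * N - 3) -> 'I_(2 * N))
    (k a : 'rV[R]_nb) : 'M[R]_(2 * N - 3) :=
  mxsub free free (stiffness x bond k a).

Definition compliance (R : realType) (N nb : nat) (x : 'I_N -> 'cV[R]_2)
    (bond : 'I_nb -> 'I_N * 'I_N) (free : 'I_(2 * N - 3) -> 'I_(2 * N))
    (k a : 'rV[R]_nb) : 'M[R]_(2 * N - 3) :=
  invmx (K_ff x bond free k a).

Definition w_vec (R : realType) (N nb : nat) (x : 'I_N -> 'cV[R]_2)
    (bond : 'I_nb -> 'I_N * 'I_N) (free : 'I_(2 * N - 3) -> 'I_(2 * N))
    (k a : 'rV[R]_nb) (b : 'I_nb) : 'cV[R]_(2 * N - 3) :=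
  compliance x bond free k a *m rowsub free (q_vec x (bond b)).

Definition z_vec (R : realType) (N nb : nat) (x : 'I_N -> 'cV[R]_2)
    (bond : 'I_nb -> 'I_N * 'I_N) (free : 'I_(2 * N - 3) -> 'I_(2 * N))
    (k a : 'rV[R]_nb) (b : 'I_nb) : 'cV[R]_(2 * N - 3) :=
  compliance x bond free k a *m rowsub free (s_vec x (bond b)).

Definition response (R : realType) (N nb mT mS : nat) (x : 'I_N -> 'cV[R]_2)
    (bond : 'I_nb -> 'I_N * 'I_N) (free : 'I_(2 * N - 3) -> 'I_(2 * N))
    (eT : 'I_mT -> 'I_(2 * N - 3)) (eS : 'I_mS -> 'I_(2 * N - 3))
    (ka : 'rV[R]_nb * 'rV[R]_nb) : 'M[R]_(mT, mS) :=
  mxsub eT eS (compliance x bond free ka.1 ka.2).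

Definition diff_image (R : realType) (nb mT mS : nat)
    (f : 'rV[R]_nb * 'rV[R]_nb -> 'M[R]_(mT, mS))
    (ka : 'rV[R]_nb * 'rV[R]_nb) : set 'M[R]_(mT, mS) :=
  range ('d f ka).

Definition bond_diff_image (R : realType) (nb mT mS : nat)
    (f : 'rV[R]_nb * 'rV[R]_nb -> 'M[R]_(mT, mS))
    (ka : 'rV[R]_nb * 'rV[R]_nb) (b : 'I_nb) : set 'M[R]_(mT, mS) :=
  [set 'd f ka (dk *: delta_mx 0 b, da *: delta_mx 0 b) |
    dk in [set: R] & da in [set: R]].

Definition trace_orth (R : realType) (m n : nat) (U : set 'M[R]_(m, n)) :
    set 'M[R]_(m, n) :=
  [set B | forall A, U A -> \tr (A^T *m B) = 0].

(* Orthogonal projection onto a linear subspace [U] for the trace inner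
   product: the element of [U] whose difference with [A] is orthogonal to
   [U]. *)
Definition orth_proj (R : realType) (m n : nat) (U : set 'M[R]_(m, n))
    (A : 'M[R]_(m, n)) : 'M[R]_(m, n) :=
  xget 0 [set B | U B /\ trace_orth U (A - B)].

Definition sym_P (R : realType) (p mT mS : nat)
    (tau : 'I_p -> 'I_mT) (sigma : 'I_p -> 'I_mS) : set 'M[R]_(mT, mS) :=
  [set A | forall r c, A (tau r) (sigma c) = A (tau c) (sigma r)].

Definition anti_P (R : realType) (p mT mS : nat)
    (tau : 'I_p -> 'I_mT) (sigma : 'I_p -> 'I_mS) : set 'M[R]_(mT, mS) :=
  trace_orth (sym_P tau sigma).

Definition Lambda2 (R : realType) (p : nat) : set 'M[R]_p :=
  [set A | A^T = - A].

Definition wedge (R : realType) (p : nat) (u v : 'cV[R]_p) : 'M[R]_p :=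
  u *m v^T - v *m u^T.

(* The linear map identifying [anti_P] with [Lambda2]; its values on the
   generators and its bijectivity are [to_Lambda2_gen] and [to_Lambda2_bij]
   below. *)
Definition to_Lambda2 (R : realType) (p mT mS : nat)
    (tau : 'I_p -> 'I_mT) (sigma : 'I_p -> 'I_mS) (A : 'M[R]_(mT, mS)) :
    'M[R]_p := mxsub tau sigma A.

Definition span_set (R : realType) (p n : nat) (f : 'I_n -> 'M[R]_p) :
    set 'M[R]_p :=
  [set` <<[seq f b | b : 'I_n]>>%VS].

Lemma to_Lambda2_gen (R : realType) (p mT mS : nat)
    (tau : 'I_p -> 'I_mT) (sigma : 'I_p -> 'I_mS)
    (tau_inj : injective tau) (sigma_inj : injective sigma) (r c : 'I_p) :
  to_Lambda2 tau sigma
    (delta_mx (tau r) (sigma c) - delta_mx (tau c) (sigma r)) =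
  wedge (delta_mx r 0) (delta_mx c 0) :> 'M[R]_p.
Proof.
apply/matrixP => i j; rewrite !mxE !big_ord1 !mxE !eqxx !andbT.
by rewrite !(inj_eq tau_inj) !(inj_eq sigma_inj) -!natrM !mulnb.
Qed.

Lemma trace_inner (R : realType) (m n : nat) (A B : 'M[R]_(m, n)) :
  \tr (A^T *m B) = \sum_i \sum_j A i j * B i j.
Proof.
rewrite /mxtrace exchange_big /=; apply: eq_bigr => j _.
by rewrite mxE; apply: eq_bigr => i _; rewrite mxE.
Qed.

Lemma trace_delta (R : realType) (m n : nat) i j (B : 'M[R]_(m, n)) :
  \tr ((delta_mx i j)^T *m B) = B i j.
Proof.
rewrite trace_inner (bigD1 i) //= (bigD1 j) //= big1 ?addr0; last first.
  by move=> k /negPf nk; rewrite mxE nk andbF mul0r.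
rewrite big1 ?addr0 ?mxE ?eqxx ?mul1r //.
move=> k /negPf nk; rewrite big1 // => l _.
by rewrite mxE nk mul0r.
Qed.

Lemma to_Lambda2_bij (R : realType) (p mT mS : nat)
    (tau : 'I_p -> 'I_mT) (sigma : 'I_p -> 'I_mS)
    (tau_inj : injective tau) (sigma_inj : injective sigma) :
  set_bij (anti_P tau sigma : set 'M[R]_(mT, mS)) (Lambda2 (R := R) (p := p))
    (to_Lambda2 tau sigma).
Proof.
have antiE (A : 'M[R]_(mT, mS)) : anti_P tau sigma A ->
    forall r c, A (tau c) (sigma r) = - A (tau r) (sigma c).
  move=> oA r c; apply/eqP; rewrite -addr_eq0; apply/eqP.
  rewrite -(trace_delta _ _ A) -(trace_delta (tau r) _ A) -mxtraceD -mulmxDl -linearD /=.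
  apply: oA => i j; rewrite !mxE !(inj_eq tau_inj) !(inj_eq sigma_inj) addrC.
  by congr (_%:R + _%:R); rewrite andbC.
have outE (A : 'M[R]_(mT, mS)) i j : anti_P tau sigma A ->
    (forall r c, ~~ ((tau r == i) && (sigma c == j))) -> A i j = 0.
  move=> oA nij; rewrite -trace_delta; apply: oA => r c.
  by rewrite !mxE (negPf (nij r c)) (negPf (nij c r)).
split.
- by move=> A oA; apply/matrixP => r c; rewrite !mxE antiE.
- move=> A B /set_mem oA /set_mem oB AB; apply/matrixP => i j.
  have [/existsP[r /existsP[c /andP[/eqP <- /eqP <-]]]|nij] :=
      boolP [exists r, exists c, (tau r == i) && (sigma c == j)].
    by move/matrixP: AB => /(_ r c); rewrite !mxE.
  have nrc r c : ~~ ((tau r == i) && (sigma c == j)).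
    by apply: contra nij => ?; apply/existsP; exists r; apply/existsP; exists c.
  by rewrite !outE.
move=> B aB.
exists (\sum_r \sum_c B r c *: delta_mx (tau r) (sigma c)).
  move=> X sX; rewrite mulmx_sumr raddf_sum /=.
  pose s := \sum_r \sum_c B r c * X (tau r) (sigma c).
  have -> : \sum_i \tr (X^T *m \sum_c B i c *: delta_mx (tau i) (sigma c)) = s.
    apply: eq_bigr => r _; rewrite mulmx_sumr raddf_sum; apply: eq_bigr => c _.
    rewrite /= -scalemxAr mxtraceZ; congr (_ * _).
    by rewrite -mxtrace_tr trmx_mul trmxK trace_delta.
  have sN : s = - s.
    rewrite {1}/s exchange_big /= -sumrN; apply: eq_bigr => r _.
    rewrite -sumrN; apply: eq_bigr => c _.
    by rewrite sX -mulNr; move/matrixP: aB => /(_ r c); rewrite !mxE => ->.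
  by apply/eqP; rewrite -[_ == _](mulrn_eq0 s 2) mulr2n {2}sN subrr.
apply/matrixP => i j; rewrite !mxE summxE (bigD1 i) //= summxE (bigD1 j) //=.
rewrite !mxE !eqxx mulr1 !big1 ?addr0 // => [r /negPf nr|c /negPf nc].
  rewrite summxE big1 // => c _.
  by rewrite !mxE (inj_eq tau_inj) eq_sym nr mulr0.
by rewrite !mxE (inj_eq sigma_inj) [j == c]eq_sym nc andbF mulr0.
Qed.

(* Main.v *)
Require Import Defs.
From HB Require Import structures.
From mathcomp Require Import all_boot all_order all_algebra.
From mathcomp Require Import boolp classical_sets functions reals.
From mathcomp Require Import topology normedtype landau derive.
From mathcomp Require Import zify ring lra.

Set Implicit Arguments.
Unset Strict Implicit.
Unset Printing Implicit Defensive.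

Import Order.TTheory GRing.Theory Num.Theory.
Import numFieldNormedType.Exports.

Local Open Scope classical_set_scope.
Local Open Scope ring_scope.

(** The differential of matrix inversion gives [dC = - C dK C], and since [C] is
    symmetric, [dK = (dk_b q_b + da_b s_b) q_b^T] yields
    [dC = - (dk_b w_b + da_b z_b) w_b^T].  On the block indexed by [P] the
    projection onto antisymmetric matrices kills the symmetric [w_b w_b^T], which
    leaves [- (da_b / 2) z_b /\ w_b].  The differential of inversion comes from
    [(A + H)^-1 - A^-1 + A^-1 H A^-1 = A^-1 H (A + H)^-1 H A^-1], of size
    [O(|H|^2)] because [(A + H)^-1] stays bounded near [H = 0]. *)

(** * Entrywise sup norm on matrices and continuity of linear maps *)

Lemma le_mx_norm (R : realType) (m n : nat) (A : 'M[R]_(m, n)) i j :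
  `|A i j| <= `|A|.
Proof.
rewrite [leRHS]/Num.norm /= mx_normrE.
exact: (le_bigmax (0 : R) (fun ij : 'I_m * 'I_n => `|A ij.1 ij.2|) (i, j)).
Qed.

Lemma mx_norm_le (R : realType) (m n : nat) (A : 'M[R]_(m, n)) (M : R) :
  0 <= M -> (forall i j, `|A i j| <= M) -> `|A| <= M.
Proof.
move=> M0 AM; rewrite [leLHS]/Num.norm /= mx_normrE.
by apply/bigmax_leP; split => // -[i j] _; exact: AM.
Qed.

(** The norm is the largest entry in absolute value, and an entry of the product is a sum of [n]
    terms; hence the factor [n]. *)
Lemma mx_norm_mul (R : realType) (m n p : nat) (A : 'M[R]_(m, n))
  (B : 'M[R]_(n, p)) : `|A *m B| <= n%:R * `|A| * `|B|.
Proof.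
apply: mx_norm_le => [|i j]; first by rewrite !mulr_ge0.
rewrite mxE (le_trans (ler_norm_sum _ _ _)) //.
rewrite -mulrA mulr_natl -[X in _ *+ X]card_ord -sumr_const ler_sum // => l _.
by rewrite normrM ler_pM // le_mx_norm.
Qed.

Lemma mx_linear_continuous (R : realType) (m n : nat) (W : normedModType R)
  (f : {linear 'M[R]_(m, n) -> W}) : continuous f.
Proof.
apply/linear_bounded_continuous/bounded_funP => r.
exists (\sum_i \sum_j r * `|f (delta_mx i j)|) => A Ar.
rewrite {1}[A]matrix_sum_delta linear_sum (le_trans (ler_norm_sum _ _ _)) //.
apply: ler_sum => i _; rewrite linear_sum (le_trans (ler_norm_sum _ _ _)) //.
apply: ler_sum => j _; rewrite linearZ normrZ ler_wpM2r //.
exact: le_trans (le_mx_norm _ _ _) Ar.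
Qed.

(** Configurations are pairs of row vectors rather than matrices. Splitting $f(A,B) = f(A,0) +
    f(0,B)$ reduces the claim to maps on one matrix space. *)
Lemma mx_pair_linear_continuous (R : realType) (m n m' n' : nat)
  (W : normedModType R)
  (f : {linear ('M[R]_(m, n) * 'M[R]_(m', n'))%type -> W}) : continuous f.
Proof.
have l1 : linear (fun A => f (A, 0)).
  move=> c A B; rewrite -linearP; congr (f _).
  by rewrite [RHS]surjective_pairing /= scaler0 addr0.
have l2 : linear (fun A => f (0, A)).
  move=> c A B; rewrite -linearP; congr (f _).
  by rewrite [RHS]surjective_pairing /= scaler0 addr0.
pose f1 : {linear _ -> _} := HB.pack (fun A => f (A, 0))
  (GRing.isLinear.Build _ _ _ _ _ l1).
pose f2 : {linear _ -> _} := HB.pack (fun A => f (0, A))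
  (GRing.isLinear.Build _ _ _ _ _ l2).
have -> : f = (fun u => f1 u.1 + f2 u.2) :> (_ -> _).
  apply/funext => -[A B] /=; rewrite -linearD; congr (f _).
  by rewrite [RHS]surjective_pairing /= addr0 add0r.
move=> u; apply: (@continuousD _ _ _ (f1 \o fst) (f2 \o snd)).
  by apply: continuous_comp; [exact: cvg_fst|exact: mx_linear_continuous].
by apply: continuous_comp; [exact: cvg_snd|exact: mx_linear_continuous].
Qed.

(** * Criteria identifying a differential *)

Lemma is_diff_linear (R : realType) (V W : normedModType R)
  (f : {linear V -> W}) (x : V) : continuous f -> is_diff x f f.
Proof.
move=> fc; apply: DiffDef; first exact: linear_differentiable.
exact: diff_lin.
Qed.

Lemma is_diff_sq_bound (R : realType) (V W : normedModType R) (f : V -> W)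
    (df : {linear V -> W}) (x : V) (M : R) :
  continuous df ->
  (\forall h \near 0, `|f (h + x) - f x - df h| <= M * `|h| ^+ 2) ->
  is_diff x f df.
Proof.
move=> dfc near_sq.
have dxf : f \o shift x = cst (f x) + df +o_ 0 id.
  apply/eqaddoP => e e0.
  near=> h.
  have -> : (f \o shift x - (cst (f x) + df)) h = f (h + x) - f x - df h.
    by rewrite opprD addrA.
  apply: le_trans (_ : M * `|h| ^+ 2 <= _); first by near: h.
  rewrite expr2 mulrA ler_wpM2r //.
  (* Unlike [M], the factor [|M| + 1] is certainly positive, so the required smallness of [h] can be
     obtained by division. *)
  apply: le_trans (_ : (`|M| + 1) * `|h| <= _).
    by rewrite ler_wpM2r // (le_trans (ler_norm _)) // lerDl.
  rewrite mulrC -ler_pdivlMr ?ltr_wpDl //; near: h.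
  by apply: cvgr0_norm_le; [exact: cvg_id|rewrite divr_gt0 ?ltr_wpDl].
have dE := diff_unique dfc dxf.
by apply: DiffDef => //; apply/diff_locallyP; rewrite dE.
Unshelve. all: by end_near. Qed.

Lemma unitmx_inj (F : fieldType) (n : nat) (A : 'M[F]_n) :
  (forall v : 'rV[F]_n, v *m A = 0 -> v = 0) -> A \in unitmx.
Proof.
move=> A_inj; rewrite -row_free_unit -kermx_eq0; apply/eqP/row_matrixP => i.
by rewrite row0; apply: A_inj; rewrite -row_mul mulmx_ker row0.
Qed.

(** * Differential of matrix inversion *)

Section InverseDifferential.
Variables (R : realType) (n : nat) (A : 'M[R]_n).
Hypothesis A_unit : A \in unitmx.
Let C := invmx A.

(** One factor [n] for each product in $v(HC)$: under this bound, multiplication by $HC$ at least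
    halves the norm. *)
Let small (H : 'M[R]_n) := n%:R * (n%:R * `|C|) * `|H| <= 2^-1.

(** If $v(H+A) = 0$, then $v = -vHC$, so $|v| \le |v|/2$ and $v = 0$. *)
Lemma unitmx_perturb (H : 'M[R]_n) : small H -> H + A \in unitmx.
Proof.
move=> sH; apply: unitmx_inj => v; rewrite mulmxDr => /eqP.
rewrite addr_eq0 => /eqP vH.
have vE : v = - (v *m (H *m C)).
  by rewrite mulmxA vH mulNmx opprK mulmxK.
have : `|v| <= `|v| / 2.
  rewrite {1}vE normrN (le_trans (mx_norm_mul _ _)) //.
  rewrite mulrAC mulrC ler_wpM2l //.
  apply: le_trans sH; rewrite -mulrA ler_wpM2l // mulrAC.
  exact: mx_norm_mul.
by rewrite ler_pdivlMr // mulr_natr mulr2n gerDl normr_le0 => /eqP.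
Qed.

(** With $B = (H+A)^{-1}$, the identity $B = C - BHC$ gives $|B| \le |C| + |B|/2$. *)
Lemma invmx_perturb_norm (H : 'M[R]_n) :
  small H -> `|invmx (H + A)| <= 2 * `|C|.
Proof.
move=> sH; have HA := unitmx_perturb sH; set B := invmx _.
have BE : B = C - B *m (H *m C).
  rewrite mulmxA -[B *m H](addrK (B *m A)) -mulmxDr mulVmx // mulmxBl mul1mx.
  by rewrite mulmxK // opprB addrC subrK.
have : `|B| <= `|C| + `|B| / 2.
  rewrite {1}BE (le_trans (ler_normB _ _)) // lerD2l.
  rewrite (le_trans (mx_norm_mul _ _)) // mulrAC mulrC ler_wpM2l //.
  apply: le_trans sH; rewrite -mulrA ler_wpM2l // mulrAC.
  exact: mx_norm_mul.
by lra.
Qed.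

Definition dinvmx : 'M[R]_n -> 'M[R]_n := fun H => - (C *m H *m C).

Lemma dinvmx_is_linear : linear dinvmx.
Proof.
move=> c H K; rewrite /dinvmx mulmxDr mulmxDl -scalemxAr -scalemxAl opprD.
by rewrite scalerN.
Qed.

HB.instance Definition _ := GRing.isLinear.Build R 'M[R]_n 'M[R]_n _ dinvmx
  dinvmx_is_linear.

Lemma is_diff_invmx : is_diff A (@invmx R n) dinvmx.
Proof.
(* The remainder $CHBHC$ has four products, each costing a factor [n], two factors $C$, and one $B$
   with $|B| \le 2|C|$. *)
apply: (is_diff_sq_bound (M := n%:R ^+ 4 * `|C| ^+ 3 * 2)).
  exact: mx_linear_continuous.
(* Since [c] is 0 when [n] is 0, the division below uses [c + 1]. *)
pose c := n%:R * (n%:R * `|C|); have c1 : 0 < c + 1.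
  by rewrite ltr_wpDl // /c !mulr_ge0.
near=> H; have sH : small H.
  apply: le_trans (_ : (c + 1) * `|H| <= _).
    by rewrite ler_wpM2r // lerDl.
  rewrite mulrC -ler_pdivlMr //; near: H.
  by apply: cvgr0_norm_le; [exact: cvg_id|rewrite divr_gt0 ?invr_gt0 ?ltr0n].
have HA := unitmx_perturb sH; have := invmx_perturb_norm sH.
set B := invmx _ => Bn.
(* Substituting $H = (H+A) - A$ gives both $C - B = CHB$ and $C - B = BHC$, whence this exact
   remainder. *)
have -> : B - invmx A - dinvmx H = C *m H *m B *m H *m C.
  have <- : C - B = C *m H *m B.
    have -> : H = (H + A) - A by rewrite addrK.
    by rewrite mulmxBr mulmxBl mulmxK // mulVmx // mul1mx.
  have -> : (C - B) *m H *m C = C *m H *m C - B *m H *m C.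
    by rewrite -mulmxA mulmxBl !mulmxA.
  have -> : B *m H *m C = C - B.
    have -> : H = (H + A) - A by rewrite addrK.
    by rewrite mulmxBr mulmxBl mulVmx // mul1mx mulmxK.
  by rewrite /dinvmx opprB opprK addrC.
have n0 : 0 <= n%:R :> R by [].
apply: le_trans (mx_norm_mul _ _) _.
apply: le_trans (_ : n%:R * (n%:R * (n%:R * (n%:R * `|C| * `|H|) * (2 * `|C|))
   * `|H|) * `|C| <= _).
  rewrite ler_wpM2r // ler_wpM2l // (le_trans (mx_norm_mul _ _)) //.
  rewrite ler_wpM2r // ler_wpM2l // (le_trans (mx_norm_mul _ _)) //.
  apply: ler_pM => //; first by rewrite mulr_ge0.
  by rewrite ler_wpM2l // mx_norm_mul.
by rewrite le_eqVlt; apply/orP; left; apply/eqP; ring.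
Unshelve. all: by end_near. Qed.

End InverseDifferential.

(** * Wedges, antisymmetric matrices and spans *)

Lemma wedge_anti (R : realType) (p : nat) (u v : 'cV[R]_p) :
  Lambda2 (wedge u v).
Proof. by rewrite /Lambda2 /= linearB /= !trmx_mul !trmxK opprB. Qed.

(** When $v_j \ne 0$, column $j$ of $uv^T = vu^T$ reads $u = (u_j/v_j)v$. *)
Lemma wedge_eq0 (R : realType) (p : nat) (u v : 'cV[R]_p) :
  wedge u v = 0 <-> ~~ free [:: u; v].
Proof.
rewrite free_cons seq1_free span_seq1 negb_and !negbK; split.
  move=> uv0; have [->|v0] := eqVneq v 0; first by rewrite orbT.
  rewrite orbF; apply/vlineP.
  have [j vj0] : exists j, v j 0 != 0 by apply/cV0Pn.
  exists (u j 0 / v j 0); apply/colP => i; rewrite mxE.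
  move/matrixP: uv0 => /(_ i j); rewrite !mxE !big_ord1 !mxE => /eqP.
  rewrite subr_eq0 => /eqP e; rewrite mulrAC [u j 0 * _]mulrC -e.
  by rewrite mulfK.
case/orP=> [/vlineP[c ->]|/eqP->].
  by rewrite /wedge -scalemxAl linearZ /= -scalemxAr subrr.
by rewrite /wedge trmx0 mulmx0 mul0mx subrr.
Qed.

Lemma Lambda2_le1 (R : realType) (p : nat) (A : 'M[R]_p) :
  (p <= 1)%N -> Lambda2 A -> A = 0.
Proof.
move=> p1 aA; apply/matrixP => i j; rewrite mxE.
have -> : j = i.
  apply/val_inj/eqP; rewrite /= eqn_leq.
  have := ltn_ord i; have := ltn_ord j; lia.
move/matrixP: aA => /(_ i i); rewrite !mxE => /eqP.
by rewrite -addr_eq0 -mulr2n mulrn_eq0 => /eqP.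
Qed.

Lemma span_setP (R : realType) (p n : nat) (f : 'I_n -> 'M[R]_p)
  (B : 'M[R]_p) :
  span_set f B <-> exists c : 'rV[R]_n, B = \sum_b c 0 b *: f b.
Proof.
rewrite /span_set /=; split=> [Bf|[c ->]]; last first.
  apply: memv_suml => b _; apply/memvZ/memv_span.
  by apply/mapP; exists b => //; rewrite mem_enum.
pose X := [tuple f b | b < n].
have BX : B \in <<X>>%VS.
  by rewrite (eq_span (Y := [seq f b | b : 'I_n])) // => y; rewrite /X /=.
exists (\row_b coord X b B); rewrite {1}(coord_span BX).
by apply: eq_bigr => b _; rewrite mxE -tnth_nth tnth_mktuple.
Qed.

(** * Orthogonal projection onto the antisymmetric block *)

Section AntisymmetricBlock.
Variables (R : realType) (p mT mS : nat).
Variables (tau : 'I_p -> 'I_mT) (sigma : 'I_p -> 'I_mS).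
Hypotheses (tau_inj : injective tau) (sigma_inj : injective sigma).
Let Pi := orth_proj (anti_P (R := R) tau sigma).

Lemma trace_orthB (U : set 'M[R]_(mT, mS)) A B :
  trace_orth U A -> trace_orth U B -> trace_orth U (A - B).
Proof. by move=> UA UB X UX; rewrite mulmxBr linearB /= UA // UB // subrr. Qed.

(** The projection is a choice by [xget], so an explicit candidate [B], the lift of the
    antisymmetric half of the block, is shown to qualify and to be the only one. *)
Lemma orth_projP A : anti_P tau sigma (Pi A) /\
  to_Lambda2 tau sigma (Pi A) =
    2^-1 *: (to_Lambda2 tau sigma A - (to_Lambda2 tau sigma A)^T).
Proof.
have [_ _ surj] := to_Lambda2_bij R tau_inj sigma_inj.
set G := RHS; have aG : Lambda2 G.
  by rewrite /Lambda2 /G /= linearZ /= linearB /= trmxK -scalerN opprB.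
have [B aB BG] := surj _ aG.
have orthB : trace_orth (anti_P tau sigma) (A - B).
  (* As [X] is orthogonal to [sym_P], it suffices that $A - B$ is symmetric on the block. *)
  move=> X aX; rewrite -mxtrace_tr trmx_mul trmxK.
  apply: aX => r c.
  have e i j : B (tau i) (sigma j) = 2^-1 *
      (A (tau i) (sigma j) - A (tau j) (sigma i)).
    by move/matrixP: BG => /(_ i j); rewrite !mxE.
  by rewrite !mxE !e; lra.
have ex : [set B | anti_P tau sigma B /\
  trace_orth (anti_P tau sigma) (A - B)] B by [].
rewrite /Pi /orth_proj.
case: xgetP => [D _ [aD oD]|/(_ B)//].
suff -> : D = B by split.
have aDB : anti_P tau sigma (D - B) by exact: trace_orthB.
have /(_ _ aDB) : trace_orth (anti_P tau sigma) (D - B).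
  have -> : D - B = (A - B) - (A - D) by rewrite [RHS]addrC opprB addrA subrK.
  exact: trace_orthB.
(* $D - B$ is orthogonal to itself, so the squares of its entries sum to zero. *)
rewrite trace_inner => /eqP; rewrite psumr_eq0; last first.
  by move=> i _; apply: sumr_ge0 => j _; rewrite -expr2 sqr_ge0.
move=> /allP s0; apply/subr0_eq/matrixP => i j; rewrite [RHS]mxE.
have := s0 i (mem_index_enum i); rewrite /= psumr_eq0; last first.
  by move=> l _; rewrite -expr2 sqr_ge0.
move=> /allP /(_ j (mem_index_enum j)) /=.
by rewrite -expr2 sqrf_eq0 => /eqP.
Qed.

Lemma orth_proj_eq0 A : Pi A = 0 <-> to_Lambda2 tau sigma (Pi A) = 0.
Proof.
have [_ inj _] := to_Lambda2_bij R tau_inj sigma_inj.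
have t0 : to_Lambda2 tau sigma (0 : 'M[R]_(mT, mS)) = 0.
  by apply/matrixP => i j; rewrite !mxE.
split=> [->//|A0]; apply: inj; rewrite ?inE ?t0 //.
  by have [] := orth_projP A.
by move=> X _; rewrite mulmx0 linear0.
Qed.

End AntisymmetricBlock.

(** * Differential of the response block *)

Section ResponseDifferential.
Variables (R : realType) (N nb : nat).
Variables (x : 'I_N -> 'cV[R]_2) (bond : 'I_nb -> 'I_N * 'I_N).
Variable (dof : 'I_(2 * N - 3) -> 'I_(2 * N)).

Let qf b := rowsub dof (q_vec x (bond b)).
Let sf b := rowsub dof (s_vec x (bond b)).

Lemma K_ffE (k a : 'rV[R]_nb) :
  K_ff x bond dof k a = \sum_b (k 0 b *: qf b + a 0 b *: sf b) *m (qf b)^T.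
Proof.
apply/matrixP => i j; rewrite mxE !summxE; apply: eq_bigr => b _.
by rewrite !mxE !big_ord1 !mxE.
Qed.

(** Uncurried so that joint linearity in $(k,a)$ can be registered as an instance and the map
    differentiated. *)
Definition K_ff_pair (ka : 'rV[R]_nb * 'rV[R]_nb) : 'M[R]_(2 * N - 3) :=
  K_ff x bond dof ka.1 ka.2.

Lemma K_ff_pair_is_linear : linear K_ff_pair.
Proof.
move=> c u v; rewrite /K_ff_pair !K_ffE scaler_sumr -big_split /=.
apply: eq_bigr => b _; rewrite !mxE scalemxAl -mulmxDl; congr (_ *m _).
by rewrite scalerDr !scalerDl !scalerA addrACA.
Qed.

HB.instance Definition _ := GRing.isLinear.Build R
  ('rV[R]_nb * 'rV[R]_nb)%type 'M[R]_(2 * N - 3) _ K_ff_pair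
  K_ff_pair_is_linear.

Variables (k a : 'rV[R]_nb) (mT mS : nat).
Variables (eT : 'I_mT -> 'I_(2 * N - 3)) (eS : 'I_mS -> 'I_(2 * N - 3)).
Hypothesis K_inv : K_ff x bond dof k a \in unitmx.

(** Chain rule through linear assembly of the stiffness, inversion, and linear extraction of the
    block. *)
Lemma is_diff_response :
  is_diff (k, a) (response x bond dof eT eS)
    (fun h => mxsub eT eS (dinvmx (K_ff x bond dof k a) (K_ff_pair h))).
Proof.
have dK : is_diff (k, a) K_ff_pair K_ff_pair.
  exact/is_diff_linear/mx_pair_linear_continuous.
have dI : is_diff (K_ff_pair (k, a)) (@invmx R _) (dinvmx (K_ff_pair (k, a))).
  exact: is_diff_invmx.
have dS B : is_diff B (mxsub eT eS : 'M[R]_(2 * N - 3) -> _) (mxsub eT eS).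
  exact/is_diff_linear/mx_linear_continuous.
exact: is_diff_comp (is_diff_comp dK dI) (dS _).
Qed.

Hypothesis K_sym : (K_ff x bond dof k a)^T = K_ff x bond dof k a.
Let w := w_vec x bond dof k a.
Let z := z_vec x bond dof k a.

(* Symmetry of the compliance turns each [q_b^T C] into [w_b^T]. *)
Lemma dinvmx_K_ff (h : 'rV[R]_nb * 'rV[R]_nb) :
  dinvmx (K_ff x bond dof k a) (K_ff_pair h) =
  - \sum_b (h.1 0 b *: w b + h.2 0 b *: z b) *m (w b)^T.
Proof.
rewrite /dinvmx /K_ff_pair (K_ffE h.1); congr (- _).
rewrite mulmx_sumr mulmx_suml; apply: eq_bigr => b _.
rewrite /w /z /w_vec /z_vec /compliance trmx_mul trmx_inv K_sym !mulmxA.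
by rewrite mulmxDr !scalemxAr.
Qed.

Variables (p : nat) (eP : 'I_p -> 'I_(2 * N - 3)).
Variables (tau : 'I_p -> 'I_mT) (sigma : 'I_p -> 'I_mS).
Hypotheses (tau_inj : injective tau) (sigma_inj : injective sigma).
Hypotheses (tauE : forall r, eT (tau r) = eP r).
Hypotheses (sigmaE : forall r, eS (sigma r) = eP r).

(* The stiffness directions contribute the symmetric terms [w_b w_b^T], which
   the projection kills; only the odd couplings survive. *)
Lemma proj_diff_response (h : 'rV[R]_nb * 'rV[R]_nb) :
  to_Lambda2 tau sigma (orth_proj (anti_P tau sigma)
    ('d (response x bond dof eT eS) (k, a) h)) =
  \sum_b (- (h.2 0 b / 2)) *: wedge (rowsub eP (z b)) (rowsub eP (w b)).
Proof.
have dR := is_diff_response.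
have [_ ->] := orth_projP tau_inj sigma_inj
  ('d (response x bond dof eT eS) (k, a) h).
rewrite diff_val dinvmx_K_ff; apply/matrixP => i j.
rewrite !mxE !tauE !sigmaE !summxE -opprD mulrN -sumrN -big_split /=.
rewrite mulr_sumr -sumrN.
apply: eq_bigr => b _; rewrite !mxE !big_ord1 !mxE; lra.
Qed.

End ResponseDifferential.

Theorem theorem16 (R : realType) (N nb : nat)
  (* network *)
  (x : 'I_N -> 'cV[R]_2) (bond : 'I_nb -> 'I_N * 'I_N)
  (len_gt0 : forall b, 0 < bond_len x (bond b))
  (* pinned and free degrees of freedom *)
  (pinned : {set 'I_(2 * N)}) (pinned3 : #|pinned| = 3%N)
  (pinned_rigid : removes_rigid x pinned)
  (free_dof : 'I_(2 * N - 3) -> 'I_(2 * N))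
  (free_dofE : enumerates free_dof (~: pinned))
  (* driven set S, read set T, and P = T :&: S, each with a fixed ordering *)
  (S T : {set 'I_(2 * N - 3)}) (mS mT p : nat)
  (eS : 'I_mS -> 'I_(2 * N - 3)) (eSE : enumerates eS S)
  (eT : 'I_mT -> 'I_(2 * N - 3)) (eTE : enumerates eT T)
  (eP : 'I_p -> 'I_(2 * N - 3)) (ePE : enumerates eP (T :&: S))
  (* positions of the elements of P inside T and S *)
  (tau : 'I_p -> 'I_mT) (tauE : forall r, eT (tau r) = eP r)
  (sigma : 'I_p -> 'I_mS) (sigmaE : forall r, eS (sigma r) = eP r)
  (* configuration *)
  (k a : 'rV[R]_nb) (k_gt0 : forall b, 0 < k 0 b)
  (K_sym : (K_ff x bond free_dof k a)^T = K_ff x bond free_dof k a)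
  (K_inv : K_ff x bond free_dof k a \in unitmx) :
  let Resp := response x bond free_dof eT eS in
  let Pi := orth_proj (anti_P (R := R) tau sigma) in
  let zP b := rowsub eP (z_vec x bond free_dof k a b) in
  let wP b := rowsub eP (w_vec x bond free_dof k a b) in
  let wedges := span_set (fun b => wedge (zP b) (wP b)) in
  [/\ differentiable Resp (k, a),
      to_Lambda2 tau sigma @` (Pi @` diff_image Resp (k, a)) = wedges
        /\ wedges `<=` Lambda2 (R := R) (p := p),
      Pi @` diff_image Resp (k, a) = anti_P tau sigma <->
        wedges = Lambda2 (R := R) (p := p),
      forall b,
        [/\ Pi @` bond_diff_image Resp (k, a) b = [set 0] <->
              ~~ free [:: zP b; wP b],
            wedge (zP b) (wP b) = 0 <-> ~~ free [:: zP b; wP b]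
          & zP b = 0 \/ wP b = 0 -> ~~ free [:: zP b; wP b]]
    & (p <= 1)%N -> forall b,
        Pi @` bond_diff_image Resp (k, a) b = [set 0]
        /\ wedge (zP b) (wP b) = 0].
Proof.
move=> Resp Pi zP wP wedges.
have [eP_inj _] := ePE.
have tau_inj : injective tau.
  by move=> r c rc; apply: eP_inj; rewrite -!tauE rc.
have sigma_inj : injective sigma.
  by move=> r c rc; apply: eP_inj; rewrite -!sigmaE rc.
pose t := to_Lambda2 (R := R) tau sigma.
have [t_anti t_inj t_surj] := to_Lambda2_bij R tau_inj sigma_inj.
have Pi_anti A : anti_P tau sigma (Pi A).
  by have [] := orth_projP tau_inj sigma_inj A.
have dE := proj_diff_response K_inv K_sym tau_inj sigma_inj tauE sigmaE.
have dR := is_diff_response eT eS K_inv.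
have imE : t @` (Pi @` diff_image Resp (k, a)) = wedges.
  apply/seteqP; split=> [_ [_ [_ [h _ <-] <-] <-]|B /span_setP[c ->]].
    apply/span_setP; exists (\row_b (- (h.2 0 b / 2))).
    by rewrite [LHS]dE; apply: eq_bigr => b _; rewrite mxE.
  (* The factor $-2$ cancels the coefficient $-da_b/2$; no change of stiffness is needed. *)
  pose h : 'rV[R]_nb * 'rV[R]_nb := (0, \row_b (- (2 * c 0 b))).
  exists (Pi ('d Resp (k, a) h)).
    by exists ('d Resp (k, a) h) => //; exists h.
  rewrite [LHS]dE; apply: eq_bigr => b _; rewrite mxE; congr (_ *: _).
  by lra.
have wL : wedges `<=` Lambda2 (R := R) (p := p).
  by rewrite -imE => _ [_ [A _ <-] <-]; exact/t_anti.
have bond_dE b dk da : t (Pi ('d Resp (k, a)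
    (dk *: delta_mx 0 b, da *: delta_mx 0 b))) =
    (- (da / 2)) *: wedge (zP b) (wP b).
  rewrite [LHS]dE (bigD1 b) //= big1 ?addr0; last first.
    by move=> l /negPf lb; rewrite !mxE lb andbF mulr0 mul0r oppr0 scale0r.
  by rewrite !mxE !eqxx mulr1.
have bondE b : Pi @` bond_diff_image Resp (k, a) b = [set 0] <->
    wedge (zP b) (wP b) = 0.
  split=> [im0|w0].
    (* The increment $da = -2$ makes the coefficient of the wedge equal to 1. *)
    pose D := 'd Resp (k, a) (0 *: delta_mx 0 b, (- 2) *: delta_mx 0 b).
    have : (Pi @` bond_diff_image Resp (k, a) b) (Pi D).
      by exists D => //; exists 0 => //; exists (- 2).
    rewrite im0 => /(orth_proj_eq0 tau_inj sigma_inj).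
    by rewrite -/(t _) bond_dE mulNr opprK divff ?pnatr_eq0 // scale1r.
  have z0 dk da : Pi ('d Resp (k, a)
      (dk *: delta_mx 0 b, da *: delta_mx 0 b)) = 0.
    apply/(orth_proj_eq0 tau_inj sigma_inj).
    by rewrite -/(t _) bond_dE w0 scaler0.
  apply/seteqP; split=> [_ [_ [dk _ [da _ <-]] <-]|_ ->]; first exact: z0.
  (* Equality with [[set 0]] also needs 0 to be attained; the zero increment does this. *)
  exists ('d Resp (k, a) (0 *: delta_mx 0 b, 0 *: delta_mx 0 b)) => //.
  by exists 0 => //; exists 0.
split.
- exact: ex_diff.
- by [].
- split=> [im_anti|wedgesL].
    rewrite -imE im_anti; apply/seteqP; split=> [_ [A aA <-]|].
      exact: t_anti.
    by move=> B /t_surj.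
  apply/seteqP; split=> [_ [A _ <-]|A aA]; first exact: Pi_anti.
  (* Some projected differential has the same image as [A] under [t]; injectivity of [t] on [anti_P]
     identifies the two. *)
  have : wedges (t A) by rewrite wedgesL; exact: t_anti.
  rewrite -imE => -[B [C dC <-] BA]; exists C => //.
  by apply: t_inj => //; rewrite inE.
- move=> b; split; first by rewrite bondE wedge_eq0.
    exact: wedge_eq0.
  rewrite -wedge_eq0 /wedge.
  by case=> ->; rewrite trmx0 !(mulmx0, mul0mx) subrr.
- move=> p1 b; have w0 : wedge (zP b) (wP b) = 0.
    exact: Lambda2_le1 p1 (wedge_anti _ _).
  by split=> //; apply/bondE.
Qed.
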